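(* Let $(R,\delta)$ be an $m_1$-inverse loop with permutation $J_R:R\to R$ such that $J_R(\delta)=\delta$ and $J_R^{h_1}\in\mathrm{Aut}(R)$, and let $(S,\delta)$ be an $m_2$-inverse loop with permutation $J_S:S\to S$ such that $J_S(\delta)=\delta$ and $J_S^{h_2}\in\mathrm{Aut}(S)$ (with $m_1,m_2,h_1,h_2\in\mathbb{Z}$). Let $\varphi:S\times R\to R$ be a map satisfying \begin{align*} &\varphi(\delta,r)=r,\qquad \varphi(s,\delta)=\delta,\\ &\varphi\big(J_S^m(ss'),\varphi(J_S^{m+1}(s),r)\big)=\varphi(J_S^m(s'),r),\\ &\varphi(s,J_R^m(rr'))\,\varphi(s,J_R^{m+1}(r))=\varphi(s,J_R^m(r')), \end{align*} for all $r,r'\in R$, all $s,s'\in S$, and all $m\in\mathbb{Z}$ with $m\equiv m_1\ (\mathrm{mod}\ h_1)$ and $m\equiv m_2\ (\mathrm{mod}\ h_2)$. Then, for such $m$, the set $R\rtimes S:=R\times S$ with identity $(\delta,\delta)$ is an $m$-inverse loop with the multiplication $$(r,s)(r',s'):=\big(r\,\varphi(s,r'),\,ss'\big)$$ and the permutation $$J:R\rtimes S\to R\rtimes S,\qquad J(r,s):=(\delta,J_S(s))(J_R(r),\delta)=\big(\varphi(J_S(s),J_R(r)),\,J_S(s)\big),$$ if and only if, for all $s,s'\in S$ and all $r\in R$, $$\begin{cases}\varphi(s,r)=r & \text{if } m \text{ is even},\\ \varphi\big(J_S^m(ss'),\varphi(s,r)\big)=\varphi(J_S^m(s'),r) & \text{if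 } m\text{ is odd}.\end{cases}$$
   Context: A quasigroup is a set $Q$ with a binary multiplication such that for all $a,b\in Q$ there are unique $x,y\in Q$ with $ax=b$ and $ya=b$. A loop is a quasigroup with an identity element $\delta$, i.e. $x\delta=\delta x=x$ for all $x$. For $m\in\mathbb{Z}$, a loop $Q$ is an $m$-inverse loop (also called $m$-invertible loop) with permutation $J:Q\to Q$ if $J$ is a bijection satisfying $xJ(x)=\delta$ and $J^m(xy)\,J^{m+1}(x)=J^m(y)$ for all $x,y\in Q$. $\mathrm{Aut}(Q)$ denotes the group of bijections $f:Q\to Q$ with $f(xy)=f(x)f(y)$. *)

(* Defs.v *)
From mathcomp Require Import all_boot all_order all_algebra.
From mathcomp Require Import boolp classical_sets functions.

Set Implicit Arguments.
Unset Strict Implicit.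
Unset Printing Implicit Defensive.

Local Open Scope ring_scope.

Section Loops.
Variables (Q : Type) (mul : Q -> Q -> Q) (e : Q).

Definition is_quasigroup : Prop :=
  forall a b : Q,
    (exists! x, mul a x = b) /\ (exists! y, mul y a = b).

Definition is_loop : Prop :=
  is_quasigroup /\ (forall x, mul x e = x /\ mul e x = x).

Definition is_loop_aut (f : Q -> Q) : Prop :=
  bijective f /\ {morph f : x y / mul x y}.

End Loops.

(* The integer powers J^m of a self-map J.  For a bijective J the library's
   pseudo-inverse 'pinv_id setT J is the inverse map; the powers are only used
   for bijective J. *)
Definition iterz (Q : Type) (J : Q -> Q) (m : int) : Q -> Q :=
  match m with
  | Posz n => iter n J
  | Negz n => iter n.+1 ('pinv_id [set: Q] J)
  end.

Definition is_minverse_loop (Q : Type) (mul : Q -> Q -> Q) (e : Q)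
    (m : int) (J : Q -> Q) : Prop :=
  [/\ is_loop mul e,
      bijective J,
      forall x, mul x (J x) = e &
      forall x y,
        mul (iterz J m (mul x y)) (iterz J (m + 1) x) = iterz J m y].

Section SemidirectProduct.
Variables (R S : Type) (mulR : R -> R -> R) (eR : R)
          (mulS : S -> S -> S) (eS : S)
          (JR : R -> R) (JS : S -> S) (phi : S -> R -> R).

Definition sd_mul (u v : R * S) : R * S :=
  (mulR u.1 (phi u.2 v.1), mulS u.2 v.2).

Definition sd_J (u : R * S) : R * S :=
  sd_mul (eR, JS u.2) (JR u.1, eS).

End SemidirectProduct.

(* Main.v *)
(* Two consequences of the hypotheses on phi drive the proof: phi_(J_S s) is the
   inverse of phi_s, and every phi_s is an automorphism of R, hence commutes with
   J_R.  Therefore J^m (r, s) is (J_R^m r, J_S^m s) for even m and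
   (phi_s^-1 (J_R^m r), J_S^m s) for odd m, so R x S is always a loop with
   u * J u = 1, and the first component of the m-inverse identity is equivalent
   to the stated condition. *)
Require Import Defs.
From mathcomp Require Import all_boot all_order all_algebra zify.
From mathcomp Require Import classical_sets functions.

Set Implicit Arguments.
Unset Strict Implicit.
Unset Printing Implicit Defensive.

Import GRing.Theory.

Local Open Scope ring_scope.

(** The equivalence in the step covers both directions of the integers at once: a step that applies
    a bijection is reversible, so negative exponents need no argument of their own. *)
Lemma int_step_ind (P : int -> Prop) :
  P 0 -> (forall m, P m <-> P (m + 1)) -> forall m, P m.
Proof.
move=> P0 PS; elim/int_ind => [//|n Pn|n Pn].
- by rewrite -addn1 PoszD; apply: (PS n).1.
- by apply: (PS _).2; rewrite -addn1 PoszD opprD addrNK.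
Qed.

Lemma dvdz2D1 (m : int) : (2 %| m + 1)%Z = ~~ (2 %| m)%Z.
Proof. lia. Qed.

Section IntegerIterates.
Variables (Q : Type) (J : Q -> Q) (bijJ : bijective J).

Lemma pinv_idK : cancel J ('pinv_id [set: Q] J).
Proof. by move=> x; apply: pinvKV; [exact: in2W (bij_inj bijJ) | rewrite inE]. Qed.

Lemma pinv_idVK : cancel ('pinv_id [set: Q] J) J.
Proof.
by move=> x; have [g gK Kg] := bijJ; rewrite -{1}[x]Kg pinv_idK Kg.
Qed.

Lemma iterzS (m : int) (x : Q) : iterz J (m + 1) x = J (iterz J m x).
Proof.
case: m => n; first by rewrite -PoszD addn1.
case: n => [|n]; first by rewrite /= pinv_idVK.
have -> : Negz n.+1 + 1 = Negz n by rewrite !NegzE -(addn1 n.+1) PoszD opprD addrNK.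
by rewrite [in RHS]/iterz iterS pinv_idVK.
Qed.

(** The recurrence runs backwards as well because [J] is injective, so the value at 0 fixes the
    whole sequence. Identities between integer powers thereby reduce to a one-step check. *)
Lemma iterz_unique (f : int -> Q) :
  (forall m, f (m + 1) = J (f m)) -> forall m, f m = iterz J m (f 0).
Proof.
move=> fS; apply: int_step_ind => // m; rewrite fS iterzS.
by split=> [->|/(bij_inj bijJ)].
Qed.

Lemma iterzD (m n : int) (x : Q) : iterz J (m + n) x = iterz J m (iterz J n x).
Proof.
have fS k : iterz J (k + 1 + n) x = J (iterz J (k + n) x).
  by rewrite addrAC iterzS.
by rewrite (iterz_unique fS) add0r.
Qed.

Lemma iterzK (m : int) : cancel (iterz J m) (iterz J (- m)).
Proof. by move=> x; rewrite -iterzD addNr. Qed.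

Lemma iterzVK (m : int) : cancel (iterz J (- m)) (iterz J m).
Proof. by move=> x; rewrite -iterzD subrr. Qed.

Lemma iterzSr (m : int) (x : Q) : iterz J (m + 1) x = iterz J m (J x).
Proof. exact: iterzD. Qed.

Lemma iterz_fix (m : int) (x : Q) : J x = x -> iterz J m x = x.
Proof. by move=> Jx; rewrite -(@iterz_unique (fun=> x)). Qed.

Lemma iterz_comm (f : Q -> Q) (m : int) (x : Q) :
  (forall y, f (J y) = J (f y)) -> f (iterz J m x) = iterz J m (f x).
Proof.
move=> fJ; apply: (@iterz_unique (fun k => f (iterz J k x))) => k.
by rewrite iterzS fJ.
Qed.

End IntegerIterates.

Section LoopTheory.
Variables (Q : Type) (mul : Q -> Q -> Q) (e : Q).
Hypothesis loopQ : is_loop mul e.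

Lemma loop_mulI (a : Q) : injective (mul a).
Proof.
move=> x y xy; have [[z [_ zu]] _] := loopQ.1 a (mul a y).
by rewrite -(zu x xy) (zu y).
Qed.

Lemma loop_divl (a b : Q) : exists x, mul a x = b.
Proof. by have [[x []]] := loopQ.1 a b; exists x. Qed.

Lemma loop_mulx1 (x : Q) : mul x e = x. Proof. exact: (loopQ.2 x).1. Qed.

Lemma loop_mul1x (x : Q) : mul e x = x. Proof. exact: (loopQ.2 x).2. Qed.

(** Both sides are right inverses of [f x], and left cancellation makes such an inverse unique. *)
Lemma loop_morph_inverse (J f : Q -> Q) : (forall x, mul x (J x) = e) ->
  {morph f : x y / mul x y} -> f e = e -> forall x, f (J x) = J (f x).
Proof. by move=> mulJ fM f1 x; apply: (@loop_mulI (f x)); rewrite -fM !mulJ. Qed.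

End LoopTheory.

(** Applying the automorphism J^h to the inverse identity raises its exponent by h; injectivity of
    J^h lowers it again. This brings R and S to the common exponent m. *)
Lemma minverse_loop_eqmod (Q : Type) (mul : Q -> Q -> Q) (e : Q) (J : Q -> Q)
    (m n h : int) :
  is_loop_aut mul (iterz J h) -> (m = n %[mod h])%Z ->
  is_minverse_loop mul e n J -> is_minverse_loop mul e m J.
Proof.
move=> [_ JhM] /eqP; rewrite eqz_mod_dvd => /dvdzP [k mn].
have {m mn} -> : m = n + k * h by rewrite -mn addrC subrK.
move=> [loopQ bijJ mulJ invJ]; split=> //; move: k.
apply: int_step_ind => [|k]; first by rewrite mul0r addr0.
have -> : n + (k + 1) * h = h + (n + k * h) by lia.
move: (n + k * h) => p; rewrite -addrA; split=> inv x y; last apply: (can_inj (iterzK bijJ h)).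
  by rewrite !(iterzD bijJ h) -JhM inv.
by rewrite JhM -!(iterzD bijJ h).
Qed.

Section SemidirectTheory.
Variables (R S : Type) (mulR : R -> R -> R) (eR : R) (JR : R -> R).
Variables (mulS : S -> S -> S) (eS : S) (JS : S -> S) (phi : S -> R -> R).
Hypotheses (loopR : is_loop mulR eR) (loopS : is_loop mulS eS).
Hypotheses (bijJR : bijective JR) (bijJS : bijective JS).
Hypothesis mulJS : forall s, mulS s (JS s) = eS.
Hypothesis mulJR : forall r, mulR r (JR r) = eR.
Hypothesis phi1 : forall r, phi eS r = r.
Hypothesis phiM : forall s, {morph phi s : x y / mulR x y}.
Hypothesis phi_unit : forall s, phi s eR = eR.
Hypothesis phiJ : forall s, cancel (phi (JS s)) (phi s).

Local Notation mul := (sd_mul mulR mulS phi).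
Local Notation J := (sd_J mulR eR mulS eS JR JS phi).

Lemma sd_JE (r : R) (s : S) : J (r, s) = (phi (JS s) (JR r), JS s).
Proof. by rewrite /sd_J /sd_mul /= (loop_mul1x loopR) (loop_mulx1 loopS). Qed.

(** Surjectivity of [JS] writes s as [JS t], and [phi t] is a left inverse of [phi (JS t)]. *)
Lemma phi_inj (s : S) : injective (phi s).
Proof. by have [g _ Kg] := bijJS; rewrite -[s]Kg; exact: can_inj (phiJ _). Qed.

Lemma phiJV (s : S) : cancel (phi s) (phi (JS s)).
Proof. by move=> r; apply: (@phi_inj s); rewrite phiJ. Qed.

Lemma phiJJ (s : S) (r : R) : phi (JS (JS s)) r = phi s r.
Proof. by apply: (@phi_inj (JS s)); rewrite phiJ phiJV. Qed.

Lemma phi_JR (s : S) (r : R) : phi s (JR r) = JR (phi s r).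
Proof. exact: (loop_morph_inverse loopR mulJR (phiM s) (phi_unit s)). Qed.

Lemma phi_iterzJR (m : int) (s : S) (r : R) :
  phi s (iterz JR m r) = iterz JR m (phi s r).
Proof. by apply: iterz_comm => // y; exact: phi_JR. Qed.

Lemma phi_iterzJS (m : int) (s : S) (r : R) :
  phi (iterz JS m s) r = if (2 %| m)%Z then phi s r else phi (JS s) r.
Proof.
move: m s; apply: int_step_ind => // m; rewrite dvdz2D1; split=> phiE s.
  by rewrite iterzSr // phiE phiJJ; case: (2 %| m)%Z.
(* The backward step uses the induction hypothesis at the preimage [g s] of s under [JS]. *)
have [g _ Kg] := bijJS.
by rewrite -[s]Kg -iterzSr // phiE phiJJ; case: (2 %| m)%Z.
Qed.

Lemma sd_loop : is_loop mul (eR, eS).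
Proof.
split=> [[a s] [b t]|[r s]]; last first.
  by rewrite /sd_mul /= phi_unit phi1 (loop_mulx1 loopR) (loop_mulx1 loopS) (loop_mul1x loopR) (loop_mul1x loopS).
split.
- have [y yt] := loop_divl loopS s t; have [x xb] := loop_divl loopR a b.
  exists (phi (JS s) x, y); split=> [|[x' y']]; first by rewrite /sd_mul /= phiJ xb yt.
  rewrite /sd_mul /= => -[xb' yt']; congr pair; last first.
    by apply: (loop_mulI loopS (a := s)); rewrite yt.
  apply: (@phi_inj s); rewrite phiJ.
  by apply: (loop_mulI loopR (a := a)); rewrite xb.
(* The equation in R involves [phi y], so the component in S is solved first. *)
- have [_ [y [yt yu]]] := loopS.1 s t.
  have [_ [x [xb xu]]] := loopR.1 (phi y a) b.
  exists (x, y); split=> [|[x' y']]; first by rewrite /sd_mul /= xb yt.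
  rewrite /sd_mul /= => -[xb' /yu yy']; subst y'.
  by rewrite (xu x').
Qed.

Lemma sd_J_bij : bijective J.
Proof.
have [gR gRK KgR] := bijJR; have [gS gSK KgS] := bijJS.
(* The second component of J (r, s) returns s, and then [phi s] undoes [phi (JS s)]. *)
exists (fun u => (gR (phi (gS u.2) u.1), gS u.2)) => -[r s]; rewrite sd_JE /=.
- by rewrite gSK phiJ gRK.
- by rewrite !KgR -{1}[s]KgS gSK phiJV KgS.
Qed.

Lemma sd_mulJ (u : R * S) : mul u (J u) = (eR, eS).
Proof. by case: u => r s; rewrite sd_JE /sd_mul /= phiJ mulJR mulJS. Qed.

(** Passing from k to k + 1 applies [phi (iterz JS (k + 1) s)], alternately the inverse of [phi s]
    and [phi s] itself; these commute with [JR] and cancel in pairs. *)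
Lemma sd_iterzJ (m : int) (r : R) (s : S) :
  iterz J m (r, s)
  = (if (2 %| m)%Z then iterz JR m r else phi (JS s) (iterz JR m r), iterz JS m s).
Proof.
pose f k := (if (2 %| k)%Z then iterz JR k r else phi (JS s) (iterz JR k r),
             iterz JS k s).
rewrite -[LHS](_ : f m = _) //; apply: (iterz_unique sd_J_bij) => k.
rewrite /f sd_JE -(iterzS bijJS) phi_iterzJS dvdz2D1 (iterzS bijJR).
by case: (2 %| k)%Z; rewrite //= -phi_JR phiJ.
Qed.

End SemidirectTheory.

Theorem proposition2p7 (R S : Type)
    (mulR : R -> R -> R) (eR : R) (JR : R -> R)
    (mulS : S -> S -> S) (eS : S) (JS : S -> S)
    (m1 m2 h1 h2 : int) (phi : S -> R -> R)
    (loopR : is_minverse_loop mulR eR m1 JR)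
    (JR_unit : JR eR = eR)
    (JR_aut : is_loop_aut mulR (iterz JR h1))
    (loopS : is_minverse_loop mulS eS m2 JS)
    (JS_unit : JS eS = eS)
    (JS_aut : is_loop_aut mulS (iterz JS h2))
    (phi_unitS : forall r : R, phi eS r = r)
    (phi_unitR : forall s : S, phi s eR = eR)
    (phi_S : forall (r : R) (s s' : S) (m : int),
       (m = m1 %[mod h1])%Z -> (m = m2 %[mod h2])%Z ->
       phi (iterz JS m (mulS s s')) (phi (iterz JS (m + 1) s) r)
       = phi (iterz JS m s') r)
    (phi_R : forall (r r' : R) (s : S) (m : int),
       (m = m1 %[mod h1])%Z -> (m = m2 %[mod h2])%Z ->
       mulR (phi s (iterz JR m (mulR r r'))) (phi s (iterz JR (m + 1) r))
       = phi s (iterz JR m r')) :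
  (forall (r : R) (s : S),
     sd_J mulR eR mulS eS JR JS phi (r, s) = (phi (JS s) (JR r), JS s))
  /\
  (forall m : int,
     (m = m1 %[mod h1])%Z -> (m = m2 %[mod h2])%Z ->
     is_minverse_loop (sd_mul mulR mulS phi) (eR, eS) m
       (sd_J mulR eR mulS eS JR JS phi)
     <->
     (forall (s s' : S) (r : R),
        if (2 %| m)%Z then phi s r = r
        else phi (iterz JS m (mulS s s')) (phi s r) = phi (iterz JS m s') r)).
Proof.
split=> [r s|m m_m1 m_m2].
  by apply: sd_JE; [case: loopR | case: loopS].
have [loopR' bijJR mulJR invR] := minverse_loop_eqmod JR_aut m_m1 loopR.
have [loopS' bijJS mulJS invS] := minverse_loop_eqmod JS_aut m_m2 loopS.
have phiJ s : cancel (phi (JS s)) (phi s).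
  (* With J_S^(-m) s and the identity as the two elements of S, the outer index becomes s, the inner
     one J_S s, and the right side r. *)
  move=> r; have := phi_S r (iterz JS (- m) s) eS m m_m1 m_m2.
  by rewrite (loop_mulx1 loopS') iterzS // iterzVK // iterz_fix // phi_unitS.
(* Every a is J^(m+1) r and every b is J^m (r r') for suitable r and r', and
   then b a = J^m r', so phi_R says that phi s preserves the product b a. *)
have phiM s : {morph phi s : x y / mulR x y}.
  move=> b a; pose r := iterz JR (- (m + 1)) a.
  have [r' rr'] := loop_divl loopR' r (iterz JR (- m) b).
  have := phi_R r r' s m m_m1 m_m2; have := invR r r'.
  by rewrite rr' !iterzVK // => -> ->.
have sdJ r s := sd_iterzJ loopR' loopS' bijJR bijJS mulJR phiM phi_unitR phiJ m r s.
have sdJS r s :=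
  sd_iterzJ loopR' loopS' bijJR bijJS mulJR phiM phi_unitR phiJ (m + 1) r s.
have phiJR s r : phi s (iterz JR m r) = iterz JR m (phi s r).
  exact: (phi_iterzJR loopR' bijJR mulJR phiM phi_unitR).
have phiJS := phi_iterzJS bijJS phiJ m.
have JR1 k : iterz JR k eR = eR by rewrite iterz_fix.
split=> [[_ _ _ inv] s s' r|cond].
  (* The unit of R makes the second factor act trivially in the first component, and J_R^(-m)
     cancels the power J_R^m, leaving exactly the condition. *)
  have := inv (eR, s) (iterz JR (- m) r, s').
  rewrite [sd_mul _ _ _ (eR, s) _]/sd_mul /= !sdJ sdJS !dvdz2D1 !JR1 !phi_unitR.
  rewrite (loop_mul1x loopR') -phiJR iterzVK // phiJS if_same /sd_mul /=.
  by rewrite phi_unitR (loop_mulx1 loopR') phiJS; case: (2 %| m)%Z => -[].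
split.
- exact: (sd_loop loopR' loopS' bijJS phi_unitS phi_unitR phiJ).
- exact: (sd_J_bij loopR' loopS' bijJR bijJS phiJ).
- exact: (sd_mulJ loopR' loopS' mulJS mulJR phiJ).
move=> [r s] [r' s']; rewrite [sd_mul _ _ _ (r, s) _]/sd_mul /= !sdJ sdJS dvdz2D1.
rewrite /sd_mul /= invS; congr pair.
move: cond phiJS; case: (2 %| m)%Z => cond phiJS /=.
  (* For even m the action is trivial, so the product is direct and [invR] suffices. *)
  have phi_id t x : phi t x = x by exact: (cond t eS).
  by rewrite !phi_id invR.
(* For odd m both factors are images under [phi (iterz JS m (mulS s s'))]; pulling it out leaves the
   inverse identity of R, and [cond] absorbs the remaining [phi s]. *)
by rewrite -!phiJS -phiM invR -phiJR cond.
Qed.
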